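(* Let $\mathcal{C}$ be a linear $(n,k,d,r,\delta)$-LRC over the finite field $\mathbb{F}_q$ (that is, an $[n,k,d]$ linear code over $\mathbb{F}_q$ with all-symbol locality $(r,\delta)$, where $r,\delta$ are positive integers), and let $\kappa_B$ be an integer which is an upper bound on the dimension of linear codes over $\mathbb{F}_q$ of length $r+\delta-1$ and minimum distance at least $\delta$. Then $$d \leq n - \left\lceil \frac{k}{\kappa_B} \right\rceil \mathcal{G}(\kappa_B, \delta) + \mathcal{G}(\kappa_B - b, \delta),$$ where $b=k-1 - \left( \left\lceil \frac{k}{\kappa_B} \right\rceil -1 \right) \kappa_B$.
   Context: $[n]=\{1,\dots,n\}$. An $[n,k,d]$ linear code over $\mathbb{F}_q$ has length $n$, dimension $k\ge 1$ and minimum (Hamming) distance $d$. For $I\subseteq[n]$, $\mathcal{C}|_I=\{\mathbf{c}_I:\mathbf{c}\in\mathcal{C}\}$. The zero code is regarded as having infinite minimum distance. Locality: an $[n,k,d]$ linear code $\mathcal{C}$ has all-symbol locality $(r,\delta)$ if for every $i\in[n]$ there is a set $R\subseteq[n]$ (a repair set) with (1) $i\in R$, (2) $|R|\le r+\delta-1$, (3) the minimum distance of $\mathcal{C}|_R$ is at least $\delta$. Griesmer function over $\mathbb{F}_q$: $\mathcal{G}(k,d)=\sum_{i=0}^{k-1}\lceil d/q^i\rceil$. *)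

(* Defs.v *)
From HB Require Import structures.
From mathcomp Require Import all_boot all_order all_algebra.
From mathcomp Require Import zify.

Set Implicit Arguments.
Unset Strict Implicit.
Unset Printing Implicit Defensive.

Import Order.TTheory GRing.Theory Num.Theory.
Local Open Scope ring_scope.

Definition ceil_div (m p : nat) : nat := ((m + p.-1) %/ p)%N.

Lemma ceil_divE (m p : nat) :
  (0 < p)%N -> (ceil_div m p)%:Z = Num.ceil (m%:R / p%:R : rat).
Proof.
move=> p_gt0; apply/esym/eqP.
have p0 : 0 < p%:R :> rat by rewrite ltr0n.
rewrite ceil_eq.
set c := ceil_div m p.
have le1 : (m <= c * p)%N by rewrite /c /ceil_div; lia.
have le2 : (c * p < m + p)%N by rewrite /c /ceil_div; lia.
rewrite ltr_pdivlMr // ler_pdivrMr // -[c%:~R]/(c%:R : rat).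
rewrite -natrM ler_nat le1 andbT rmorphB /= mulrBl mul1r ltrBlDr.
by rewrite -natrM -natrD ltr_nat.
Qed.

Definition griesmer (q k d : nat) : nat := (\sum_(i < k) ceil_div d (q ^ i))%N.

Section Codes.
Variable F : finFieldType.

Definition hamming_dist (n : nat) (u v : 'rV[F]_n) : nat :=
  #|[set i : 'I_n | u 0 i != v 0 i]|.

(* The zero code satisfies this for every d: its minimum distance is infinite. *)
Definition min_dist_ge (n : nat) (C : {vspace 'rV[F]_n}) (d : nat) : Prop :=
  forall u v, u \in C -> v \in C -> u != v -> (d <= hamming_dist u v)%N.

Definition is_min_dist (n : nat) (C : {vspace 'rV[F]_n}) (d : nat) : Prop :=
  min_dist_ge C d /\
  exists u v, [/\ u \in C, v \in C, u != v & hamming_dist u v = d].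

Definition is_linear_code (n k d : nat) (C : {vspace 'rV[F]_n}) : Prop :=
  [/\ (0 < k)%N, (\dim C = k)%N & is_min_dist C d].

(* C|_I as a code of length #|I|: the coordinates in I are kept, in the order
   of [enum I]. *)
Definition restrict_code (n : nat) (I : {set 'I_n}) (C : {vspace 'rV[F]_n}) :
    {vspace 'rV[F]_#|I|} :=
  (linfun (colsub (@enum_val _ (mem I)) : 'rV[F]_n -> 'rV[F]_#|I|) @: C)%VS.

Lemma mem_restrict_code (n : nat) (I : {set 'I_n}) (C : {vspace 'rV[F]_n})
    (w : 'rV[F]_#|I|) :
  reflect (exists2 c, c \in C & w = \row_(j < #|I|) c 0 (enum_val j))
          (w \in restrict_code I C).
Proof.
apply: (iffP memv_imgP) => -[c cC ->]; exists c => //.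
  by rewrite lfunE; apply/rowP=> j; rewrite !mxE.
by rewrite lfunE; apply/rowP=> j; rewrite !mxE.
Qed.

Definition all_symbol_locality (n : nat) (C : {vspace 'rV[F]_n})
    (r delta : nat) : Prop :=
  forall i : 'I_n, exists R : {set 'I_n},
    [/\ i \in R, (#|R| <= r + delta - 1)%N
      & min_dist_ge (restrict_code R C) delta].

Definition is_LRC (n k d r delta : nat) (C : {vspace 'rV[F]_n}) : Prop :=
  is_linear_code k d C /\ all_symbol_locality C r delta.

Definition dim_upper_bound (len dist kappa : nat) : Prop :=
  forall D : {vspace 'rV[F]_len}, min_dist_ge D dist -> (\dim D <= kappa)%N.

End Codes.

(* The truncated subtractions in k - 1 - (ceil(k / kappa) - 1) * kappa are exact,
   and the value is less than kappa, as soon as k and kappa are positive. *)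
Lemma ceil_div_subE (k kappa : nat) : (0 < k)%N -> (0 < kappa)%N ->
  let b := (k - 1 - (ceil_div k kappa - 1) * kappa)%N in
  b%:Z = k%:Z - 1 - ((ceil_div k kappa)%:Z - 1) * kappa%:Z /\ (b < kappa)%N.
Proof.
move=> k0 p0 b; rewrite /b.
set c := ceil_div k kappa.
have le1 : (k <= c * kappa)%N by rewrite /c /ceil_div; lia.
have le2 : (c * kappa < k + kappa)%N by rewrite /c /ceil_div; lia.
by case: c le1 le2 => [|c]; split; nia.
Qed.

(* A bound [kappa] on these dimensions is positive as soon as [len] is positive
   and at least [dist]: the repetition code has dimension 1. *)
Lemma dim_upper_bound_gt0 (F : finFieldType) (len dist kappa : nat) :
  (0 < len)%N -> (dist <= len)%N ->
  dim_upper_bound F len dist kappa -> (0 < kappa)%N.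
Proof.
move=> len0 le_dist /(_ <[const_mx 1]>%VS); rewrite dim_vline.
have nz : const_mx 1 != 0 :> 'rV[F]_len.
  by apply/eqP=> /rowP/(_ (Ordinal len0)); rewrite !mxE; apply/eqP/oner_neq0.
rewrite nz; apply=> u v /vlineP[a ->] /vlineP[b ->] neq_uv.
rewrite /hamming_dist (_ : [set i | _] = setT) ?cardsT ?card_ord //.
apply/setP=> i; rewrite !inE !mxE !mulr1.
by apply: contraNneq neq_uv => ->.
Qed.

(* Main.v *)
(* Greedily build a set I of coordinates on which C has rank k - 1; a nonzero
   codeword then vanishes on I, so d <= n - |I|. Each step raises the rank by
   one inside a current repair set R, replaced once it is exhausted: if the
   subcode S of C vanishing on I still has dimension m > 0 on R, averaging over
   the points of a projective space yields at least ceil(delta / q^(m-1))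
   coordinates of R, nonzero on S, that become zero together. Writing H for the
   extension of G(m) = griesmer q m delta with H(x + kappa) = H(x) + G(kappa),
   concavity of G gives H(x + y) <= H(x) + G(y) for y <= kappa, which keeps the
   inequality H(rank + m) <= |I| + G(m) true when R is replaced; the other steps
   leave rank + m unchanged. At rank k - 1, one more use of the subadditivity,
   with y = kappa - b, turns this inequality into the bound on |I|. *)
Require Import Defs.
From mathcomp Require Import all_boot all_order all_algebra.
From mathcomp Require Import zify.

Set Implicit Arguments.
Unset Strict Implicit.
Unset Printing Implicit Defensive.

Import Order.TTheory GRing.Theory Num.Theory.
Local Open Scope ring_scope.

(** * Concavity and subadditivity of the Griesmer function *)

Section GriesmerArithmetic.
Local Open Scope nat_scope.

Lemma leq_ceil_div (m p c : nat) : 0 < p -> (ceil_div m p <= c) = (m <= c * p).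
Proof. by move=> p0; apply/idP/idP; rewrite /ceil_div => h; nia. Qed.

Lemma ceil_div_anti (m p p' : nat) :
  0 < p -> p <= p' -> ceil_div m p' <= ceil_div m p.
Proof.
move=> p0 le_pp'; rewrite leq_ceil_div ?(leq_trans p0) //.
have: m <= ceil_div m p * p by rewrite -leq_ceil_div.
by move/leq_trans; apply; rewrite leq_mul2l le_pp' orbT.
Qed.

Lemma griesmer0 (q delta : nat) : griesmer q 0 delta = 0.
Proof. exact: big_ord0. Qed.

Lemma griesmerS (q m delta : nat) :
  griesmer q m.+1 delta = griesmer q m delta + ceil_div delta (q ^ m).
Proof. exact: big_ord_recr. Qed.

Variables (q delta kappa : nat).
Hypotheses (q_gt0 : 0 < q) (kappa_gt0 : 0 < kappa).
Let G m := griesmer q m delta.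

(** The increments [ceil_div delta (q ^ m)] of [G] do not grow with [m]. *)
Lemma griesmer_concave (z x t : nat) (le_zx : z <= x) :
  G (x + t) + G z <= G x + G (z + t).
Proof.
elim: t => [|t IHt]; first by rewrite !addn0 addnC.
rewrite !addnS /G !griesmerS addnAC addnA leq_add // ceil_div_anti //.
  by rewrite expn_gt0 q_gt0.
by rewrite leq_pexp2l // leq_add2r.
Qed.

(* The sum of G over a list of integers in [0, kappa] with sum x is smallest
   when all but one of the nonzero entries equal kappa: this is its value. *)
Definition griesmer_ext (x : nat) : nat := x %/ kappa * G kappa + G (x %% kappa).

(** The boundary case [m = kappa] matters, since a code on a repair set may reach dimension [kappa];
    there the quotient rises by one and the remainder contributes [G 0 = 0]. *)
Lemma griesmer_extMD (t m : nat) :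
  m <= kappa -> griesmer_ext (t * kappa + m) = t * G kappa + G m.
Proof.
rewrite /griesmer_ext leq_eqVlt => /predU1P[->|lt_m].
  by rewrite -mulSnr mulnK // modnMl /G griesmer0 addn0 mulSnr.
by rewrite divnMDl // divn_small // addn0 modnMDl modn_small.
Qed.

Lemma griesmer_extD (x y : nat) :
  y <= kappa -> griesmer_ext (x + y) <= griesmer_ext x + G y.
Proof.
move=> le_y; have lt_s : x %% kappa < kappa by rewrite ltn_mod.
rewrite {1}(divn_eq x kappa) -addnA {2}/griesmer_ext.
move: (x %/ kappa) (x %% kappa) lt_s => t s lt_s.
have [le_sy|/ltnW le_sy] := leqP (s + y) kappa.
  rewrite griesmer_extMD // -addnA leq_add2l.
  by have := griesmer_concave y (leq0n s); rewrite /G griesmer0 addn0 add0n.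
(* Overflow: concavity trades the summands [s], [y] for the more spread out pair [kappa],
   [s + y - kappa] of equal sum. *)
rewrite -(subnKC le_sy) addnA -mulSnr griesmer_extMD; last by lia.
rewrite mulSnr -!addnA leq_add2l.
have /(griesmer_concave (kappa - s)): s + y - kappa <= s by lia.
rewrite (subnKC (ltnW lt_s)).
by have -> : s + y - kappa + (kappa - s) = y by lia.
Qed.

End GriesmerArithmetic.

Section Codes.
Variable F : finFieldType.

(** * Averaging over the points of a projective space *)

Lemma card_set_sum (T : finType) (P : pred T) :
  #|[set x | P x]| = (\sum_x P x)%N.
Proof.
by rewrite -sum1dep_card big_mkcond; apply: eq_bigr => x _; case: (P x).
Qed.

(** Choose [i] with [v i 0] nonzero: on every line of direction [delta_mx 0 i] the functional
    vanishes at exactly one point. Counting each [u] once per shift [a] avoids division. *)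
Lemma card_functional_neq0 (m : nat) (v : 'cV[F]_m) : v != 0 ->
  ((\sum_(u : 'rV[F]_m) ((u *m v) 0%R 0%R != 0%R)) * #|F| = #|F| ^ m * #|F|.-1)%N.
Proof.
case/cV0Pn=> i vi0.
transitivity (\sum_(u : 'rV[F]_m) \sum_(a : F)
    (((u + a *: delta_mx 0 i)%R *m v)%R 0%R 0%R != 0%R))%N.
  rewrite exchange_big /= mulnC -sum_nat_const; apply: eq_bigr => a _.
  by rewrite [LHS](reindex_inj (addIr (a *: delta_mx 0 i))).
rewrite -[in RHS](mul1n m) -card_mx -sum_nat_const.
apply: eq_bigr => u _; rewrite -(cardsC1 (- (u *m v) 0 0 / v i 0)).
rewrite -sum1_card [RHS]big_mkcond /=; apply: eq_bigr => a _.
rewrite mulmxDl -scalemxAl -rowE !mxE !inE addrC addr_eq0.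
by rewrite -(can2_eq (mulfK vi0) (divfK vi0)); case: (_ == _).
Qed.

Lemma mulmx_colE (m N : nat) (A : 'M[F]_(m, N)) (u : 'rV[F]_m) (j : 'I_N) :
  (u *m col j A) 0 0 = (u *m A) 0 j.
Proof. by rewrite !mxE; apply: eq_bigr => i _; rewrite mxE. Qed.

Definition parallel_cols (m N : nat) (A : 'M[F]_(m, N)) (v : 'cV[F]_m) :=
  [set j | [exists a : F, (a != 0) && (v == a *: col j A)]].

(* Double counting of the pairs (u, j) with (u *m A) 0 j != 0, for u a nonzero
   message: the columns of A represent points of the projective space of
   dimension m, and some point is hit by at least delta / q ^ m columns. *)
Lemma exists_heavy_column (m N delta : nat) (A : 'M[F]_(m.+1, N)) :
  (0 < delta)%N ->
  (forall u : 'rV[F]_m.+1, u != 0 ->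
     (delta <= #|[set j | (u *m A) 0%R j != 0%R]|)%N) ->
  exists2 v : 'cV[F]_m.+1, v != 0 &
    (delta <= #|F| ^ m * #|parallel_cols A v|)%N.
Proof.
move=> delta_gt0 wtA.
pose c v := #|parallel_cols A v|.
pose N0 := (\sum_(j < N) (col j A != 0%R))%N.
have q_gt1 := card_finRing_gt1 F.
have sum_wt : (\sum_(u : 'rV[F]_m.+1 | u != 0%R)
                 #|[set j | (u *m A) 0%R j != 0%R]|
               = #|F| ^ m * (N0 * #|F|.-1))%N.
  apply/eqP; rewrite -(eqn_pmul2r (ltnW q_gt1)) mulnAC -expnSr; apply/eqP.
  rewrite mulnCA /N0 !big_distrl /=.
  transitivity (\sum_(u : 'rV[F]_m.+1) \sum_(j < N)
                  ((u *m col j A)%R 0%R 0%R != 0%R) * #|F|)%N.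
    rewrite [RHS](bigD1 0) //= [X in _ = (X + _)%N]big1 ?add0n => [|j _]; last first.
      by rewrite mul0mx mxE eqxx.
    apply: eq_bigr => u _; rewrite -big_distrl card_set_sum /=.
    congr (_ * _)%N; apply: eq_bigr => j _.
    by rewrite mulmx_colE.
  rewrite exchange_big; apply: eq_bigr => j _; rewrite -big_distrl /=.
  have [->|/card_functional_neq0->] := eqVneq (col j A) 0; last by rewrite mul1n.
  by rewrite big1 => [|u _]; rewrite ?mul0n // mulmx0 mxE eqxx.
(* A nonzero column is parallel to exactly [#|F| - 1] nonzero vectors, its nonzero multiples; a zero
   column to none. *)
have sum_c : (\sum_(v : 'cV[F]_m.+1 | v != 0%R) c v = N0 * #|F|.-1)%N.
  rewrite /N0 big_distrl /=.
  under eq_bigr => v _ do rewrite /c card_set_sum.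
  rewrite exchange_big; apply: eq_bigr => j _ /=.
  rewrite big_mkcond /=.
  transitivity #|[set v : 'cV[F]_m.+1 | (v != 0) &&
                   [exists a : F, (a != 0) && (v == a *: col j A)]]|.
    by rewrite card_set_sum; apply: eq_bigr => v _; case: (v != 0).
  have [->|w_nz] := eqVneq (col j A) 0.
    rewrite mul0n; apply/eqP; rewrite cards_eq0; apply/eqP/setP=> v; rewrite !inE.
    apply/negP=> /andP[/negP v_nz /existsP[a]].
    by rewrite scaler0 => /andP[_ /v_nz].
  rewrite mul1n -(cardsC1 (0 : F)).
  have inj_scale : injective (fun a : F => a *: col j A).
    move=> a a' /eqP; rewrite -subr_eq0 -scalerBl scaler_eq0 (negbTE w_nz) orbF.
    by rewrite subr_eq0 => /eqP.
  rewrite -(card_imset [set~ 0] inj_scale); apply: eq_card => v.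
  rewrite !inE; apply/andP/imsetP=> [[_ /existsP[a /andP[a_nz /eqP->]]]|[a]].
    by exists a; rewrite ?inE.
  rewrite !inE => a_nz ->; rewrite scaler_eq0 negb_or a_nz w_nz; split=> //.
  by apply/existsP; exists a; rewrite a_nz eqxx.
have card_nz n1 n2 : #|[pred u : 'M[F]_(n1, n2) | u != 0]| = (#|F| ^ (n1 * n2)).-1.
  by rewrite -card_mx -(cardsC1 0) -cardsE; apply: eq_card => u; rewrite !inE.
have nz_gt0 : (0 < (#|F| ^ m.+1).-1)%N.
  by rewrite -subn1 subn_gt0 -{1}(expn0 #|F|) ltn_exp2l.
(* Otherwise each of the [#|F| ^ m.+1 - 1] nonzero [v] contributes at most [delta - 1] to a sum that
   is at least [delta] times their number. *)
have [v /andP[]|noV] := pickP (fun v => (v != 0) && (delta <= #|F| ^ m * c v)%N).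
  by exists v.
have lb : ((#|F| ^ m.+1).-1 * delta <= #|F| ^ m * (N0 * #|F|.-1))%N.
  rewrite -sum_wt -{1}[m.+1]mul1n -card_nz -sum_nat_const; apply: leq_sum => u.
  exact: wtA.
have ub : (#|F| ^ m * (N0 * #|F|.-1) <= (#|F| ^ m.+1).-1 * delta.-1)%N.
  rewrite -sum_c big_distrr /= -[X in (_ ^ X).-1]muln1 -card_nz -sum_nat_const.
  apply: leq_sum => v v_nz; rewrite -ltnS prednK // ltnNge.
  by have := noV v; rewrite v_nz /= => ->.
have := leq_trans lb ub; rewrite leq_pmul2l //.
by rewrite -ltnS prednK // ltnn.
Qed.

Lemma hamming_dist0 (n : nat) (u : 'rV[F]_n) :
  hamming_dist u 0 = #|[set i | u 0 i != 0]|.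
Proof. by apply: eq_card => i; rewrite !inE [X in _ != X]mxE. Qed.

(** Parallel columns of a generator matrix of [D] are coordinates proportional on [D], so they
    vanish on the same words: [E] is cut out of [D] by any one of them. *)
Lemma exists_heavy_hyperplane (N delta : nat) (D : {vspace 'rV[F]_N}) :
  (0 < delta)%N -> (0 < \dim D)%N -> min_dist_ge D delta ->
  exists (E : {vspace 'rV[F]_N}) (X : {set 'I_N}),
    [/\ (E <= D)%VS, (\dim E).+1 = \dim D,
        (ceil_div delta (#|F| ^ \dim E) <= #|X|)%N
      & forall j, j \in X -> (exists2 x, x \in D & x 0 j != 0) /\
                             (forall x, x \in E -> x 0 j = 0)].
Proof.
move=> delta_gt0 dimD distD; have [m def_m] : exists m, \dim D = m.+1.
  by exists (\dim D).-1; rewrite prednK.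
pose A : 'M[F]_(m.+1, N) := \matrix_(i < m.+1) (vbasis D)`_i.
have mulA (u : 'rV[F]_m.+1) : u *m A = \sum_(i < m.+1) u 0 i *: (vbasis D)`_i.
  by rewrite mulmx_sum_row; apply: eq_bigr => i _; rewrite rowK.
have mulA_in u : u *m A \in D.
  rewrite mulA memv_suml // => i _; rewrite memvZ // vbasis_mem // mem_nth //.
  by rewrite size_tuple def_m.
have mulA_onto x : x \in D -> exists u : 'rV[F]_m.+1, x = u *m A.
  move=> xD; exists (\row_i coord (vbasis D) (cast_ord (esym def_m) i) x).
  rewrite mulA [LHS](coord_vbasis xD) (reindex (cast_ord (esym def_m))) /=.
    by apply: eq_bigr => i _; rewrite mxE.
  by apply: onW_bij; exists (cast_ord def_m) => i; apply: val_inj.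
have mulA_nz (u : 'rV[F]_m.+1) : u != 0 -> u *m A != 0.
  case/rV0Pn=> i ui; apply: contraNneq ui => uA0.
  have /freeP/(_ (fun i => u 0 (cast_ord def_m i))) := basis_free (vbasisP D).
  move=> /(_ _ (cast_ord (esym def_m) i)); rewrite cast_ordKV => -> //.
  rewrite -[RHS]uA0 mulA [RHS](reindex (cast_ord def_m)) //.
  by apply: onW_bij; exists (cast_ord (esym def_m)) => j; apply: val_inj.
have wtA (u : 'rV[F]_m.+1) : u != 0 ->
    (delta <= #|[set j | (u *m A) 0%R j != 0%R]|)%N.
  by move=> /mulA_nz uA_nz; rewrite -hamming_dist0 distD ?mem0v.
have [v v_nz heavy] := exists_heavy_column delta_gt0 wtA.
set X := parallel_cols A v in heavy.
have colX j : j \in X -> exists2 a, a != 0 & v = a *: col j A.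
  by rewrite inE => /existsP[a /andP[a_nz /eqP->]]; exists a.
have nz_on_D j : j \in X -> exists2 x, x \in D & x 0 j != 0.
  move=> /colX[a a_nz def_v]; have /cV0Pn[i] : col j A != 0.
    by apply: contraNneq v_nz => col0; rewrite def_v col0 scaler0.
  rewrite mxE => Aij; exists (delta_mx 0 i *m A); first exact: mulA_in.
  by rewrite -rowE mxE.
have /card_gt0P[i iX] : (0 < #|X|)%N.
  by have := leq_trans delta_gt0 heavy; rewrite muln_gt0 => /andP[].
pose f : 'Hom('rV[F]_N, 'M[F]_1) := linfun (col i).
have fE x : f x 0 0 = x 0 i by rewrite lfunE !mxE.
have dimE : (\dim (D :&: lker f)).+1 = m.+1.
  rewrite -def_m -(limg_ker_dim f D) -addn1; congr addn; apply/eqP.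
  rewrite eqn_leq andbC; apply/andP; split.
    by apply: leq_trans (dimvS (subvf _)) _; rewrite dimvf.
  rewrite lt0n dimv_eq0; have [x xD] := nz_on_D i iX.
  apply: contraNneq => fD0; have := memv_img f xD.
  by rewrite fD0 memv0 => /eqP fx0; rewrite -fE fx0 mxE.
exists (D :&: lker f)%VS, X; split=> [|||j jX]; [exact: capvSl|by rewrite dimE| |].
  case: dimE => ->; rewrite leq_ceil_div 1?mulnC //.
  by rewrite expn_gt0 ltnW ?card_finRing_gt1.
split=> [|x /memv_capP[xD]]; first exact: nz_on_D.
have [u ->] := mulA_onto x xD; rewrite memv_ker => /eqP fx0.
have ui0 : (u *m col i A) 0 0 = 0 by rewrite mulmx_colE -fE fx0 mxE.
have [[a a_nz def_v] [a' a'_nz def_v']] := (colX i iX, colX j jX).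
apply/eqP; rewrite -mulmx_colE -(mulrI_eq0 _ (mulfI a'_nz)).
have -> : a' * (u *m col j A) 0 0 = a * (u *m col i A) 0 0.
  have : u *m (a' *: col j A) = u *m (a *: col i A) by rewrite -def_v -def_v'.
  by rewrite -!scalemxAr => /rowP/(_ 0); rewrite mxE [X in _ = X]mxE.
by rewrite ui0 mulr0.
Qed.

(** * Subcodes, zero padding and puncturing *)

Lemma limg_cap_preim (aT rT : vectType F) (f : 'Hom(aT, rT)) (S : {vspace aT})
    (E : {vspace rT}) :
  (E <= f @: S)%VS -> (f @: (S :&: f @^-1: E) = E)%VS.
Proof.
move=> leES; apply: subv_anti; apply/andP; split; apply/subvP=> y.
  by case/memv_imgP=> x /memv_capP[_ xE] ->; rewrite memv_preim.
move=> yE; have /memv_imgP[x xS yx] := subvP leES y yE.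
by rewrite yx memv_img // memv_cap xS -memv_preim -yx.
Qed.

(** Padding with zeros preserves dimension and distances. This covers repair sets with fewer than
    [r + delta - 1] elements. *)
Lemma dim_upper_boundS (len len' delta kappa : nat) :
  (len <= len')%N -> dim_upper_bound F len' delta kappa ->
  dim_upper_bound F len delta kappa.
Proof.
move=> le_len ub D dist_D.
pose f : 'Hom('rV[F]_len, 'rV[F]_len') :=
  linfun (mulmxr (rowsub (widen_ord le_len) 1%:M)).
have fE x i : f x 0 (widen_ord le_len i) = x 0 i.
  rewrite lfunE /= !mxE (bigD1 i) //= !mxE eqxx mulr1 big1 ?addr0 // => j ne_ji.
  by rewrite !mxE -val_eqE /= val_eqE (negbTE ne_ji) mulr0.
have f_inj : injective f.
  by move=> x y eq_f; apply/rowP=> i; rewrite -!fE eq_f.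
have -> : \dim D = \dim (f @: D)%VS.
  rewrite limg_dim_eq //; apply/eqP.
  rewrite -subv0; apply: subv_trans (capvSr _ _) _.
  by rewrite subv0; apply/lker0P.
apply: ub => _ _ /memv_imgP[x xD ->] /memv_imgP[y yD ->] ne_f.
have ne_xy : x != y by apply: contraNneq ne_f => ->.
apply: leq_trans (dist_D x y xD yD ne_xy) _; rewrite /hamming_dist.
have inj_w : injective (widen_ord le_len).
  by move=> i j /(congr1 val) eq_ij; apply: val_inj.
rewrite -(card_imset _ inj_w); apply/subset_leq_card.
by apply/subsetP=> _ /imsetP[i + ->]; rewrite !inE !fE.
Qed.

Lemma min_dist_ge_sub (n delta : nat) (C D : {vspace 'rV[F]_n}) :
  (D <= C)%VS -> min_dist_ge C delta -> min_dist_ge D delta.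
Proof. by move=> /subvP le_DC dist_C u v /le_DC uC /le_DC; apply: dist_C. Qed.

Lemma min_dist_le_card (n d : nat) (C S : {vspace 'rV[F]_n}) (I : {set 'I_n}) :
  (S <= C)%VS -> (0 < \dim S)%N ->
  (forall i c, i \in I -> c \in S -> c 0 i = 0) ->
  min_dist_ge C d -> (d + #|I| <= n)%N.
Proof.
move=> le_SC dimS vanish dist_C.
have c_nz : vpick S != 0 by rewrite vpick0 -dimv_eq0 -lt0n.
have cS := memv_pick S.
have cardI : (#|I| + #|~: I|)%N = n by rewrite cardsC card_ord.
have := dist_C _ _ (subvP le_SC _ cS) (mem0v C) c_nz.
rewrite hamming_dist0 -[X in _ -> (_ <= X)%N]cardI addnC leq_add2l.
move/leq_trans; apply; apply/subset_leq_card/subsetP=> i; rewrite !inE.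
by apply: contra => /vanish/(_ cS)->.
Qed.

Definition puncture (n : nat) (R : {set 'I_n}) : 'Hom('rV[F]_n, 'rV[F]_#|R|) :=
  linfun (colsub (@enum_val _ (mem R))).

Lemma punctureE (n : nat) (R : {set 'I_n}) (c : 'rV[F]_n) (j : 'I_#|R|) :
  puncture R c 0 j = c 0 (enum_val j).
Proof. by rewrite lfunE !mxE. Qed.

Lemma restrict_codeE (n : nat) (R : {set 'I_n}) (S : {vspace 'rV[F]_n}) :
  restrict_code R S = (puncture R @: S)%VS.
Proof. by []. Qed.

(** * The greedy choice of coordinates *)

Section Greedy.
Variables (n delta kappa : nat) (C : {vspace 'rV[F]_n}).
Hypotheses (delta_gt0 : (0 < delta)%N) (kappa_gt0 : (0 < kappa)%N).

(** The empty set qualifies too, so the construction can start before any repair set is chosen. *)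
Definition good_set (R : {set 'I_n}) : Prop :=
  min_dist_ge (restrict_code R C) delta /\
  dim_upper_bound F #|R| delta kappa.

Hypothesis cover : forall i, exists2 R : {set 'I_n}, i \in R & good_set R.

Let G m := griesmer #|F| m delta.
Let H x := griesmer_ext #|F| delta kappa x.

(** [rho] is the codimension of [S] in [C]; [G m] is the number of coordinates that [R] is still
    guaranteed to yield. *)
Definition greedy_state (rho : nat) (S : {vspace 'rV[F]_n}) (I R : {set 'I_n}) :=
  [/\ (S <= C)%VS, (\dim S + rho)%N = \dim C,
      forall i c, i \in I -> c \in S -> c 0 i = 0,
      good_set R
    & let m := \dim (restrict_code R S) in (H (rho + m) <= #|I| + G m)%N].

Lemma good_set_dim (R : {set 'I_n}) (S : {vspace 'rV[F]_n}) :
  (S <= C)%VS -> good_set R -> (\dim (restrict_code R S) <= kappa)%N.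
Proof.
move=> le_SC [distR ub]; apply: ub.
by apply: min_dist_ge_sub distR; apply: limgS.
Qed.

Lemma greedy_step_same rho S I R : greedy_state rho S I R ->
  (0 < \dim (restrict_code R S))%N -> exists S' I', greedy_state rho.+1 S' I' R.
Proof.
case=> le_SC dimS vanish goodR /= bound m_gt0.
have le_res : (restrict_code R S <= restrict_code R C)%VS by apply: limgS.
have distS := min_dist_ge_sub le_res goodR.1.
have [E [X [leE dimE cardX XP]]] := exists_heavy_hyperplane delta_gt0 m_gt0 distS.
pose f := puncture R; pose S' := (S :&: f @^-1: E)%VS.
have resS' : (restrict_code R S' = E)%VS by apply: limg_cap_preim.
exists S', (I :|: [set enum_val j | j in X]); split=> //.
- exact: subv_trans (capvSl _ _) le_SC.
- rewrite -dimS addnS -addSn; congr addn.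
  (* [S] and [S'] contain the same words vanishing on [R], so their dimensions differ as those of
     their restrictions do. *)
  rewrite -(limg_ker_dim f S') -(limg_ker_dim f S).
  rewrite -!restrict_codeE resS' -addnS dimE; congr (\dim _ + _)%N.
  rewrite -capvA; congr capv; apply/capv_idPr.
  by rewrite -lpreim0 lpreimS // sub0v.
- move=> i c; rewrite !inE => /orP[iI|/imsetP[j jX ->]] /memv_capP[cS cE].
    exact: vanish.
  by rewrite -punctureE; apply: (XP j jX).2; rewrite memv_preim.
- rewrite /= resS'; move: bound; rewrite -dimE addnS -addSn /G griesmerS.
  move/leq_trans; apply; rewrite cardsU disjoint_setI0.
    rewrite cards0 subn0 card_imset; last exact: enum_val_inj.
    by rewrite -addnA leq_add2l addnC leq_add2r.
  (* New coordinates lie outside [I]: each is nonzero on some word of [S], while [S] vanishes on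
     [I]. *)
  apply/pred0P=> i /=; apply/negP=> /andP[iI /imsetP[j jX ij]].
  have [[x + +] _] := XP j jX; rewrite restrict_codeE => /memv_imgP[c cS ->].
  by rewrite punctureE -ij vanish ?eqxx.
Qed.

Lemma greedy_step rho S I R : greedy_state rho S I R -> (0 < \dim S)%N ->
  exists S' I' R', greedy_state rho.+1 S' I' R'.
Proof.
move=> st dimS; have [m_gt0|] := boolP (0 < \dim (restrict_code R S))%N.
  by have [S' [I' ?]] := greedy_step_same st m_gt0; exists S', I', R.
rewrite -eqn0Ngt => /eqP m0; case: st => le_SC dimC vanish _ /=.
rewrite m0 addn0 /G griesmer0 addn0 => bound.
(* [R] is exhausted but [S] is nonzero: a coordinate where a word of [S] is nonzero provides the
   next repair set. *)
have : vpick S != 0 by rewrite vpick0 -dimv_eq0 -lt0n.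
case/rV0Pn=> i c_i; have [R' iR' goodR'] := cover i.
have m'_gt0 : (0 < \dim (restrict_code R' S))%N.
  rewrite lt0n dimv_eq0; apply: contraNneq c_i => res0.
  have := memv_img (puncture R') (memv_pick S).
  rewrite -restrict_codeE res0 memv0 => /eqP/rowP/(_ (enum_rank_in iR' i)).
  by rewrite punctureE mxE enum_rankK_in // => ->.
have st' : greedy_state rho S I R'.
  split=> //=; apply: leq_trans (griesmer_extD _ _ _ _ _) _.
  - by rewrite (cardD1 0).
  - exact: kappa_gt0.
  - exact: good_set_dim.
  - by rewrite leq_add2r.
by have [S' [I' ?]] := greedy_step_same st' m'_gt0; exists S', I', R'.
Qed.

Lemma greedy_run rho : (rho <= \dim C)%N -> exists S I R, greedy_state rho S I R.
Proof.
elim: rho => [_|rho IHrho lt_rho].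
  exists C, set0, set0.
  have dim0 : \dim (restrict_code set0 C) = 0%N.
    apply/eqP; rewrite -leqn0; apply: leq_trans (dimvS (subvf _)) _.
    by rewrite dimvf /dim /= cards0 muln0.
  split=> //; first by rewrite addn0.
  - by move=> i c; rewrite inE.
  - split=> [u v _ _ /eqP[]|D _].
      by apply/rowP=> j; have := enum_valP j; rewrite inE.
    apply: leq_trans (dimvS (subvf _)) _.
    by rewrite dimvf /dim /= cards0 muln0.
  - by rewrite /= dim0 /H /griesmer_ext div0n mod0n griesmer0.
have [|S [I [R st]]] := IHrho; first exact: ltnW.
by apply: (greedy_step st); case: st => _ dimS _ _ _; lia.
Qed.

End Greedy.
End Codes.

Theorem theorem3 (F : finFieldType) (n k d r delta kappa : nat)
    (C : {vspace 'rV[F]_n})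
    (r_gt0 : (0 < r)%N) (delta_gt0 : (0 < delta)%N)
    (C_LRC : is_LRC k d r delta C)
    (kappa_ub : dim_upper_bound F (r + delta - 1) delta kappa) :
  let q := #|F| in
  let b := (k - 1 - (ceil_div k kappa - 1) * kappa)%N in
  d%:Z <= n%:Z - (ceil_div k kappa)%:Z * (griesmer q kappa delta)%:Z
          + (griesmer q (kappa - b)%N delta)%:Z.
Proof.
cbv zeta; set q := #|F|; set b := (k - 1 - _)%N.
case: C_LRC => -[k_gt0 dimC [dist_C _]] locC.
(* [r_gt0] gives [delta <= r + delta - 1], so the repetition code is long enough. *)
have kappa_gt0 : (0 < kappa)%N by apply: dim_upper_bound_gt0 kappa_ub; lia.
have q_gt0 : (0 < q)%N by rewrite /q (cardD1 0).
have cover i : exists2 R : {set 'I_n}, i \in R & good_set delta kappa C R.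
  have [R [iR cardR distR]] := locC i; exists R => //; split=> //.
  exact: dim_upper_boundS kappa_ub.
(* Stopping at [k.-1] leaves [S] of dimension 1, hence a nonzero codeword. *)
have [|S [I [R [le_SC dimS vanish goodR /=]]]] :=
    greedy_run delta_gt0 kappa_gt0 cover (rho := k.-1).
  by rewrite dimC leq_pred.
set m := \dim (restrict_code R S) => bound.
have le_m : (m <= kappa)%N by apply: good_set_dim le_SC goodR.
have le_dn : (d + #|I| <= n)%N.
  by apply: min_dist_le_card le_SC _ vanish dist_C; lia.
have [b_eq b_lt] := ceil_div_subE k_gt0 kappa_gt0; rewrite -/b in b_eq b_lt.
(* As [k - 1 = (ceil_div k kappa - 1) * kappa + b], adding [kappa - b] completes a multiple of
   [kappa]. *)
have eq_k : (k.-1 + m + (kappa - b) = ceil_div k kappa * kappa + m)%N.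
  by case: (ceil_div k kappa) b_eq => [|t]; nia.
have := griesmer_extD delta q_gt0 kappa_gt0 (k.-1 + m) (leq_subr b kappa).
rewrite eq_k griesmer_extMD // => lb.
have le_nat : (d + ceil_div k kappa * griesmer q kappa delta
               <= n + griesmer q (kappa - b) delta)%N.
  (* The last repair set may be only partly used; its leftover term [griesmer q m delta] appears on
     both sides and cancels. *)
  rewrite -(leq_add2r (griesmer q m delta)) -addnA.
  apply: leq_trans (leq_add (leqnn d) lb) _.
  apply: leq_trans (leq_add (leqnn d) (leq_add bound (leqnn _))) _.
  by rewrite addnA addnA addnAC leq_add2r leq_add2r.
by lia.
Qed.
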